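(* Let $a\in[0,\tfrac13)$ and let $k\geqslant 0$ be an integer. If $a<\dfrac{1}{2^k(2^k+2)}$, then the operator $\mathcal R:L^2(S^1,\mathbb C)\to L^2(S^1,\mathbb C)$ (with parameter $a$) restricts to a map $C^k(S^1,\mathbb C)\to C^k(S^1,\mathbb C)$.
   Context: $S^1$ is identified with $\mathbb R/2\pi\mathbb Z$, and $C^k(S^1,\mathbb C)$ is the space of $k$ times continuously differentiable ($2\pi$-periodic) functions with values in $\mathbb C$. For $a\in(0,\tfrac13)$ the operator $\mathcal R:L^2(S^1,\mathbb C)\to L^2(S^1,\mathbb C)$ is defined by $$ \mathcal R(y)(t)=\sum_{\ell=0}^\infty(-1)^\ell\,\frac{\left(a+\sqrt{a^2+a}\right)^{\ell+1}-\left(a-\sqrt{a^2+a}\right)^{\ell+1}}{2\sqrt{a^2+a}}\;y\left((-1)^\ell 2^\ell t\right), $$ the series being convergent in $L^2(S^1,\mathbb C)$ (and uniformly if $y$ is continuous); for $a=0$, $\mathcal R$ is the identity. It is the inverse of the operator $\mathcal T(f)(t)=f(t)+2a f(-2t)-a f(4t)$ on $L^2(S^1,\mathbb C)$. *)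

(* Defs.v *)
From HB Require Import structures.
From mathcomp Require Import all_boot all_order all_algebra.
From mathcomp Require Import complex.
From mathcomp Require Import all_classical all_reals all_analysis.

Set Implicit Arguments.
Unset Strict Implicit.
Unset Printing Implicit Defensive.

Import Order.TTheory GRing.Theory Num.Theory.
Import numFieldNormedType.Exports.

Local Open Scope classical_set_scope.
Local Open Scope ring_scope.

(* [Rcomplex R] is the field R[i], with scalars in [R] and with the modulus as
   an [R]-valued norm.  The instances below add the topology of that norm, so
   that [continuous], [derivable] and [derive1n] apply to functions from [R]
   to the complex numbers. *)
HB.instance Definition _ (R : realType) := isPointed.Build (Rcomplex R) 0.
HB.instance Definition _ (R : realType) :=
  PseudoMetric.copy (Rcomplex R) (pseudoMetric_normed (Rcomplex R)).
HB.instance Definition _ (R : realType) :=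
  NormedZmod_PseudoMetric_eq.Build R (Rcomplex R) erefl.

Lemma Rcomplex_normrZ (R : realType) (l : R) (z : Rcomplex R) :
  `|l *: z| = `|l| * `|z|.
Proof.
case: z => x y; rewrite /Num.norm /=.
by rewrite !exprMn -mulrDr sqrtrM ?sqr_ge0// sqrtr_sqr.
Qed.

HB.instance Definition _ (R : realType) :=
  PseudoMetricNormedZmod_Lmodule_isNormedModule.Build R (Rcomplex R)
    (@Rcomplex_normrZ R).

Section Circle.
Context {R : realType}.
Local Notation mu := (@lebesgue_measure R).
Implicit Types f g y : R -> Rcomplex R.

(* A function on the circle R / 2 pi Z is a 2 pi-periodic function on R. *)
Definition Ck (k : nat) f : Prop :=
  [/\ periodic f (pi *+ 2),
      forall j, (j < k)%N -> forall t, derivable (derive1n j f) t 1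
    & continuous (derive1n k f)].

Definition L2norm f : \bar R :=
  ((\int[mu]_(t in `[0%R, (pi *+ 2)%R]) (`|f t| ^+ 2)%:E) `^ 2^-1)%E.

Definition L2fun f : Prop :=
  [/\ periodic f (pi *+ 2),
      measurable_fun setT (fun t => complex.Re (f t)),
      measurable_fun setT (fun t => complex.Im (f t))
    & (L2norm f < +oo)%E].

(* An element of L^2(S^1, C) is the set of all square-integrable functions
   that are almost everywhere equal to a given one. *)
Definition L2class f : set (R -> Rcomplex R) :=
  [set g | L2fun g /\ {ae mu, forall t, g t = f t}].

Definition L2 : set (set (R -> Rcomplex R)) := L2class @` [set f | L2fun f].

Definition CkL2 (k : nat) : set (set (R -> Rcomplex R)) :=
  L2class @` [set f | Ck k f].

Definition coefR (a : R) (l : nat) : R :=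
  ((a + Num.sqrt (a ^+ 2 + a)) ^+ l.+1 - (a - Num.sqrt (a ^+ 2 + a)) ^+ l.+1)
  / (2 * Num.sqrt (a ^+ 2 + a)).

Definition partialR (a : R) (n : nat) y : R -> Rcomplex R := fun t =>
  \sum_(0 <= l < n)
    ((-1) ^+ l * coefR a l) *: y ((-1) ^+ l * 2 ^+ l * t).

(* The operator on classes.  For [a != 0] the value at [Y] consists of the
   L^2-limits of the partial sums of the series of a representative of [Y]; it
   is empty, hence not an element of [L2], in case the series diverges. *)
Definition opR (a : R) (Y : set (R -> Rcomplex R)) : set (R -> Rcomplex R) :=
  if a == 0 then Y
  else [set g | L2fun g /\ exists2 y, Y y &
         L2norm (fun t => partialR a n y t - g t) @[n --> \oo] --> 0%E].

End Circle.

(* Main.v *)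
Require Import Defs.
From mathcomp Require Import all_boot all_order all_algebra.
From mathcomp Require Import complex.
From mathcomp Require Import all_classical all_reals all_analysis.
From mathcomp Require Import measurable_realfun.
From mathcomp Require Import ring lra.
Local Open Scope ring_scope.

(** For [a = 0] the operator is the identity.  Let [a > 0], and put
    [s = sqrt (a^2 + a)] and [r = a + s].  The coefficient of
    [y ((-2)^l t)] in the series is [O(r^l)], and [a * 2^k * (2^k + 2) < 1]
    says exactly that [2^k * r < 1] ([coefR_bound], [ratio_lt1]).  If [f] is
    [C^k], differentiating the series of [f] term by term [j <= k] times
    multiplies the coefficients by [(-2)^(j l)], and [f] and its derivatives are
    bounded by periodicity; so all derived series are dominated by geometric
    series of ratio at most [2^k * r].  They converge uniformly and the sum [F]
    is [C^k] ([Ck_dilation_series], by induction on [k] from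
    [is_derive_uniform_limit]).

    It remains to see that the operator, defined by L^2-limits of partial sums
    of arbitrary representatives, sends the class of [f] to the class of [F]
    ([opR_L2class]).  Changing the representative changes the partial sums on a
    null set only, because [t |-> (-2)^l t] preserves null sets
    ([ae_partialR]).  Uniform convergence implies convergence in L^2, and
    another L^2-limit [g] satisfies [int |g - F|^2 = 0] over a period, hence
    equals [F] almost everywhere on the line ([energy_eq0_ae]). *)

Set Implicit Arguments.
Unset Strict Implicit.
Unset Printing Implicit Defensive.
Import Order.TTheory GRing.Theory Num.Theory.
Import numFieldNormedType.Exports.
Local Open Scope classical_set_scope.

(** * The modulus, real and imaginary parts *)

Section Modulus.
Context {R : realType}.
Implicit Types z w : Rcomplex R.

Lemma sqr_modulus z : `|z| ^+ 2 = complex.Re z ^+ 2 + complex.Im z ^+ 2.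
Proof.
by case: z => x y; rewrite /Num.norm /= sqr_sqrtr// addr_ge0 ?sqr_ge0.
Qed.

Lemma normr_Re z : `|complex.Re z| <= `|z|.
Proof.
rewrite -(@ler_pXn2r _ 2)// ?nnegrE// sqr_modulus.
by rewrite real_normK ?num_real// lerDl sqr_ge0.
Qed.

Lemma normr_Im z : `|complex.Im z| <= `|z|.
Proof.
rewrite -(@ler_pXn2r _ 2)// ?nnegrE// sqr_modulus.
by rewrite real_normK ?num_real// lerDr sqr_ge0.
Qed.

Lemma modulus_le_ReIm z : `|z| <= `|complex.Re z| + `|complex.Im z|.
Proof.
rewrite -(@ler_pXn2r _ 2)// ?nnegrE ?addr_ge0// sqr_modulus sqrrD.
by rewrite !real_normK ?num_real// lerD2r lerDl mulrn_wge0// mulr_ge0.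
Qed.

Lemma sqr_modulusD_le z w : `|z + w| ^+ 2 <= 2 * `|z| ^+ 2 + 2 * `|w| ^+ 2.
Proof.
have /(@lerXn2r _ 2%N) := ler_normD z w.
rewrite !nnegrE => /(_ (normr_ge0 _) (addr_ge0 (normr_ge0 _) (normr_ge0 _))).
move=> /le_trans; apply.
have := sqr_ge0 (`|z| - `|w|); nra.
Qed.

Lemma continuous_Re : continuous (@complex.Re R : Rcomplex R -> R).
Proof.
move=> z; apply/(@cvgrPdist_lt _ _ _ (nbhs z)) => e e0; near=> w.
rewrite -(raddfB (@complex.Re R : Rcomplex R -> R)).
apply: le_lt_trans (normr_Re _) _.
by near: w; apply/(@nbhs_ballP R); exists e.
Unshelve. all: by end_near. Qed.

Lemma continuous_Im : continuous (@complex.Im R : Rcomplex R -> R).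
Proof.
move=> z; apply/(@cvgrPdist_lt _ _ _ (nbhs z)) => e e0; near=> w.
rewrite -(raddfB (@complex.Im R : Rcomplex R -> R)).
apply: le_lt_trans (normr_Im _) _.
by near: w; apply/(@nbhs_ballP R); exists e.
Unshelve. all: by end_near. Qed.

Lemma is_derive_linear_comp (L : {linear Rcomplex R -> R})
    (f : R -> Rcomplex R) (t : R) (l : Rcomplex R) :
  continuous L -> is_derive t 1 f l ->
  is_derive t 1 (fun x : R => L (f x)) (L l).
Proof.
move=> cL [fd <-].
have H : (fun h => h^-1 *: (L (f (h *: (1 : R) + t)) - L (f t))) @ (0 : R)^'
    --> L ('D_1 f t).
  have -> : (fun h => h^-1 *: (L (f (h *: (1 : R) + t)) - L (f t))) =
      L \o (fun h : R => h^-1 *: (f (h *: (1 : R) + t) - f t)).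
    by apply/funext => h; rewrite -linearB [RHS]linearZ; reflexivity.
  exact: (cvg_comp id L fd (cL _)).
split; first by apply/cvg_ex; exists (L ('D_1 f t)).
exact: cvg_lim H.
Qed.

End Modulus.

(** * Uniform limits *)

Section UniformLimits.
Context {R : realType}.

Lemma mean_value_ineq (f df : R -> R) (M : R) :
  (forall t : R, is_derive t 1 f (df t)) -> (forall t, `|df t| <= M) ->
  forall x y, `|f y - f x| <= M * `|y - x|.
Proof.
move=> fd dfM x y; wlog xy : x y / x <= y.
  move=> H; have [|/ltW] := leP x y; first exact: H.
  by rewrite distrC (distrC y); exact: H.
have [c _ ->] := MVT_segment xy (fun t _ => fd t)
  (derivable_within_continuous
    (fun t _ => @ex_derive _ _ _ _ _ _ _ (fd t))).
by rewrite normrM ler_wpM2r.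
Qed.

(** Rolle's theorem fails for complex values; applying the mean value theorem
    to the real and the imaginary part costs the factor 2. *)
Lemma mean_value_ineq_complex (f df : R -> Rcomplex R) (M : R) :
  (forall t : R, is_derive t 1 f (df t)) -> (forall t, `|df t| <= M) ->
  forall x y, `|f y - f x| <= 2 * M * `|y - x|.
Proof.
move=> fd dfM x y; apply: le_trans (modulus_le_ReIm _) _.
have HRe t := is_derive_linear_comp
  (L := @complex.Re R : {linear Rcomplex R -> R}) continuous_Re (fd t).
have HIm t := is_derive_linear_comp
  (L := @complex.Im R : {linear Rcomplex R -> R}) continuous_Im (fd t).
have BRe t : `|complex.Re (df t)| <= M by apply: le_trans (normr_Re _) (dfM t).
have BIm t : `|complex.Im (df t)| <= M by apply: le_trans (normr_Im _) (dfM t).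
have := lerD (mean_value_ineq HRe BRe x y) (mean_value_ineq HIm BIm x y).
rewrite -mulrDl -mulr2n -[M *+ 2]mulr_natl.
rewrite -(raddfB (@complex.Re R : Rcomplex R -> R)).
rewrite -(raddfB (@complex.Im R : Rcomplex R -> R)).
exact.
Qed.

(** The mean value inequality applied to [P m - P n], in the limit of large [m],
    bounds the increments of [F - P n] by [2 * e n * |h|].  The difference
    quotient of [F] thus follows that of [P n] uniformly in [h], which is what
    exchanging the two limits requires. *)
Lemma is_derive_uniform_limit (P P' : nat -> R -> Rcomplex R)
    (F G : R -> Rcomplex R) (e : nat -> R) :
  (forall n (t : R), is_derive t 1 (P n) (P' n t)) ->
  (forall n t, `|P n t - F t| <= e n) ->
  (forall n t, `|P' n t - G t| <= e n) ->
  e n @[n --> \oo] --> 0 ->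
  forall t : R, is_derive t 1 F (G t).
Proof.
move=> PP' PF PG e0 t.
have increment n h :
    `|(F (h + t) - F t) - (P n (h + t) - P n t)| <= 2 * e n * `|h|.
  apply/ler_addgt0Pr => d d0.
  (* This bound on [e m] makes both the slope error [2 * e m * |h|] and the
     replacement of [F] by [P m] at two points cost at most [d] together. *)
  have d'0 : 0 < d / (2 * `|h| + 2) by rewrite divr_gt0// ltr_wpDl// mulr_ge0.
  have /cvgrPdist_le /(_ _ d'0) [m _ /(_ m (leqnn m))] := e0.
  rewrite sub0r normrN => em.
  have {}em : e m * (2 * `|h| + 2) <= d.
    rewrite -ler_pdivlMr; last by rewrite ltr_wpDl// mulr_ge0.
    exact: le_trans (ler_norm _) em.
  have D (s : R) : is_derive s 1 (P m - P n) (P' m s - P' n s).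
    exact: is_deriveB.
  have B s : `|P' m s - P' n s| <= e m + e n.
    have -> : P' m s - P' n s = (P' m s - G s) - (P' n s - G s).
      by rewrite opprB addrA subrK.
    by apply: le_trans (ler_normB _ _) (lerD _ _).
  have := mean_value_ineq_complex D B t (h + t).
  rewrite addrK => I.
  have -> : (F (h + t) - F t) - (P n (h + t) - P n t) =
     (P m - P n) (h + t) - (P m - P n) t
       - (P m (h + t) - F (h + t)) + (P m t - F t).
    rewrite !fctE; ring.
  apply: le_trans (ler_normD _ _) _.
  apply: le_trans (lerD (ler_normB _ _) (PF _ _)) _.
  have := PF m (h + t); lra.
have H : (fun h => h^-1 *: (F (h *: (1 : R) + t) - F t)) @ (0 : R)^' --> G t.
  apply/cvgrPdist_le => eps eps0.
  have eps0' : 0 < eps / 4 by rewrite divr_gt0.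
  have /cvgrPdist_le /(_ _ eps0') [n _ /(_ n (leqnn n))] := e0.
  rewrite sub0r normrN => /(le_trans (ler_norm _)) en.
  have [PD PE] := PP' n t.
  have /cvgrPdist_le /(_ _ eps0') := PD.
  rewrite -[lim _]/('D_1 (P n) t) PE => Q.
  near=> h.
  have h0 : 0 < `|h| by rewrite normr_gt0; near: h; exact: nbhs_dnbhs_neq.
  have hQ : `|P' n t - h^-1 *: (P n (h *: (1 : R) + t) - P n t)| <= eps / 4.
    by near: h.
  rewrite [h%:A](mulr1) in hQ *.
  have I :
    `|h^-1 *: ((F (h + t) - F t) - (P n (h + t) - P n t))| <= 2 * e n.
    by rewrite normrZ normfV mulrC ler_pdivrMr.
  have -> : G t - h^-1 *: (F (h + t) - F t) =
     (P' n t - h^-1 *: (P n (h + t) - P n t)) - (P' n t - G t)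
      - h^-1 *: ((F (h + t) - F t) - (P n (h + t) - P n t)).
    rewrite [X in _ = _ - X]scalerBr; ring.
  apply: le_trans (ler_normB _ _) _.
  apply: le_trans (lerD (ler_normB _ _) I) _.
  have := PG n t; lra.
split; first by apply/cvg_ex; exists (G t).
exact: cvg_lim H.
Unshelve. all: by end_near. Qed.

Lemma continuous_uniform_limit (P : nat -> R -> Rcomplex R)
    (F : R -> Rcomplex R) (e : nat -> R) :
  (forall n, continuous (P n)) ->
  (forall n t, `|P n t - F t| <= e n) ->
  e n @[n --> \oo] --> 0 -> continuous F.
Proof.
move=> cP PF e0 t; apply/cvgrPdist_le => eps eps0.
have eps0' : 0 < eps / 3 by rewrite divr_gt0.
have /cvgrPdist_le /(_ _ eps0') [n _ /(_ n (leqnn n))] := e0.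
rewrite sub0r normrN => /(le_trans (ler_norm _)) en.
have /cvgrPdist_le /(_ _ eps0') Q := cP n t.
near=> s.
have hQ : `|P n t - P n s| <= eps / 3 by near: s.
have -> : F t - F s = (P n t - P n s) - (P n t - F t) + (P n s - F s) by ring.
apply: le_trans (ler_normD _ _) _.
apply: le_trans (lerD (ler_normB _ _) (PF _ _)) _.
have := PF n t; lra.
Unshelve. all: by end_near. Qed.

Lemma series_geometric_tail (u : nat -> R) (C q : R) :
  0 <= C -> 0 <= q < 1 -> (forall l, `|u l| <= C * q ^+ l) ->
  exists z, forall n, `|\sum_(0 <= l < n) u l - z| <= C / (1 - q) * q ^+ n.
Proof.
move=> C0 /andP[q0 q1] uC.
have uq : forall n m, `|\sum_(n <= l < n + m) u l| <= C / (1 - q) * q ^+ n.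
  move=> n m; apply: le_trans (ler_norm_sum _ _ _) _.
  have -> : C / (1 - q) * q ^+ n = C * (q ^+ n / (1 - q)) by ring.
  apply: le_trans (_ : C * \sum_(n <= l < n + m) q ^+ l <= _).
    by rewrite mulr_sumr; apply: ler_sum => l _; exact: uC.
  apply: ler_wpM2l => //.
  rewrite ler_pdivlMr ?subr_gt0//.
  have -> : (\sum_(n <= l < n + m) q ^+ l) * (1 - q) = q ^+ n - q ^+ (n + m).
    elim: m => [|m IH]; first by rewrite addn0 big_geq// mul0r subrr.
    by rewrite addnS big_nat_recr ?leq_addr//= mulrDl IH exprS; ring.
  by rewrite gerBl exprn_ge0.
have : cvgn (series u).
  apply: normed_cvg.
  apply: (@series_le_cvg _ _ (geometric C q)) => //.
  - by move=> n /=.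
  - by move=> n; apply: mulr_ge0 => //; exact: exprn_ge0.
  - by apply: is_cvg_geometric_series; rewrite ger0_norm.
move=> cu; exists (limn (series u)) => n.
apply/ler_addgt0Pr => d d0.
have /cvgrPdist_le /(_ _ d0) [m _ /(_ (n + m)%N (leq_addl _ _))] := cu.
rewrite -[lim _]/(limn (series u)) => hm.
have -> : \sum_(0 <= l < n) u l - limn (series u) =
  - (limn (series u) - series u (n + m)%N) - \sum_(n <= l < n + m) u l.
  by rewrite /series /= (@big_cat_nat _ _ _ n 0 (n + m))//= ?leq_addr//; ring.
apply: le_trans (ler_normB _ _) _.
by rewrite normrN addrC lerD.
Qed.

End UniformLimits.

(** * Periodic functions and series of dilations *)

Section Periodic.
Context {R : realType} {V : zmodType}.

Lemma periodicz (f : R -> V) T :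
  periodic f T -> forall (z : int) t, f (t + T *~ z) = f t.
Proof.
move=> fT [n|n] t; first by rewrite -pmulrn periodicn.
by rewrite NegzE mulrNz -pmulrn -(periodicn fT n.+1) subrK.
Qed.

Lemma modulo_period (T t : R) : 0 < T -> 0 <= t - T *~ Num.floor (t / T) <= T.
Proof.
move=> T0; have /andP[zt tz] := floor_itv (t / T).
rewrite -mulrzr subr_ge0 lerBlDr [T * _]mulrC.
move: zt tz; rewrite intrD ler_pdivlMr// ltr_pdivrMr// mulrDl mul1r => zt tz.
by rewrite zt ltW// addrC.
Qed.

End Periodic.

Section Dilations.
Context {R : realType}.
Implicit Types (b : nat -> R) (f : R -> Rcomplex R).

(** Partial sums and sum of the series of [b l *: f ((-2)^l t)].  The weights
    are arbitrary, since differentiation turns [b l] into [b l * (-2)^l]. *)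
Definition dilation_sum b n f : R -> Rcomplex R := fun t =>
  \sum_(0 <= l < n) b l *: f ((-2) ^+ l * t).

Definition dilation_series b f : R -> Rcomplex R := fun t =>
  limn (fun n => dilation_sum b n f t).

(** The limit is built from its real and imaginary parts, so that completeness
    is only used over the reals. *)
Lemma complex_series_geometric_tail (u : nat -> Rcomplex R) (C q : R) :
  0 <= C -> 0 <= q < 1 -> (forall l, `|u l| <= C * q ^+ l) ->
  exists z, forall n, `|\sum_(0 <= l < n) u l - z| <= 2 * C / (1 - q) * q ^+ n.
Proof.
move=> C0 q01 uC.
have [x hx] := series_geometric_tail C0 q01
  (fun l => le_trans (normr_Re (u l)) (uC l)).
have [y hy] := series_geometric_tail C0 q01
  (fun l => le_trans (normr_Im (u l)) (uC l)).
exists (Complex x y) => n; apply: le_trans (modulus_le_ReIm _) _.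
have := lerD (hx n) (hy n).
rewrite -!(raddf_sum (@complex.Re R : Rcomplex R -> R)).
rewrite -!(raddf_sum (@complex.Im R : Rcomplex R -> R)).
set S := \sum_(0 <= l < n) u l => H.
have -> : complex.Re (S - Complex x y) = complex.Re S - x by case: (S).
have -> : complex.Im (S - Complex x y) = complex.Im S - y by case: (S).
by apply: le_trans H _; rewrite -mulrDl -mulrDl -mulr2n -[C *+ 2]mulr_natl.
Qed.

Lemma cvg_geometric_bound (C q : R) :
  0 <= q < 1 -> C * q ^+ n @[n --> \oo] --> 0.
Proof.
by move=> /andP[q0 q1]; apply: cvg_geometric; rewrite ger0_norm.
Qed.

(** All arguments [(-2)^l t] are covered by the single bound [M], so the
    domination by a geometric series, and hence the rate, is uniform in [t]. *)
Lemma dilation_series_dist b f (C r M : R) :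
  0 <= r < 1 -> (forall l, `|b l| <= C * r ^+ l) -> (forall t, `|f t| <= M) ->
  forall n t, `|dilation_sum b n f t - dilation_series b f t|
     <= 2 * (C * M) / (1 - r) * r ^+ n.
Proof.
move=> r01 bC fM n t.
have C0 : 0 <= C by have := bC 0; rewrite expr0 mulr1; apply: le_trans.
have M0 : 0 <= M by apply: le_trans (fM 0).
have [|z hz] := @complex_series_geometric_tail
  (fun l => b l *: f ((-2) ^+ l * t)) (C * M) r (mulr_ge0 C0 M0) r01.
  move=> l; rewrite normrZ mulrAC; apply: ler_pM => //.
suff : dilation_sum b n f t @[n --> \oo] --> z.
  by move=> /cvg_lim Hz; rewrite /dilation_series Hz//; exact: hz.
apply/cvgrPdist_le => e e0.
have /cvgrPdist_le /(_ _ e0) H :=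
  @cvg_geometric_bound (2 * (C * M) / (1 - r)) _ r01.
near=> m; rewrite distrC; apply: le_trans (hz m) _.
apply: le_trans (ler_norm _) _.
by rewrite -normrN -sub0r; near: m.
Unshelve. all: by end_near. Qed.

Lemma is_derive_dilation f f' (c : R) :
  (forall t : R, is_derive t 1 f (f' t)) ->
  forall t : R, is_derive t 1 (fun s => f (c * s)) (c *: f' (c * t)).
Proof.
move=> ff' t.
have [fd <-] := ff' (c * t).
have df : differentiable f (c * t) by apply/derivable1_diffP.
have hm : is_derive t 1 ( *%R c) c.
  by have := is_deriveZ c (is_derive_id t (1 : R)); rewrite [c *: 1]mulr1.
have dm : differentiable ( *%R c) t.
  by apply/derivable1_diffP; exact: ex_derive.
split; first by apply/derivable1_diffP; exact: differentiable_comp.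
rewrite deriveE; last exact: differentiable_comp.
rewrite diff_comp//= -[X in 'd f _ X]deriveE// derive_val.
by rewrite deriveE// -linearZ/= [_ *: 1]mulr1.
Qed.

Lemma is_derive_dilation_sum b f f' n :
  (forall t : R, is_derive t 1 f (f' t)) ->
  forall t : R, is_derive t 1 (dilation_sum b n f)
     (dilation_sum (fun l => b l * (-2) ^+ l) n f' t).
Proof.
move=> ff' t.
have -> : dilation_sum b n f =
    \sum_(l < n) (fun s => b l *: f ((-2) ^+ l * s)).
  by apply/funext => s; rewrite fct_sumE /dilation_sum big_mkord.
rewrite /dilation_sum big_mkord.
apply: is_derive_sum => l; rewrite -scalerA.
by apply: is_deriveZ; exact: is_derive_dilation.
Qed.

Lemma continuous_dilation_sum b f n :
  continuous f -> continuous (dilation_sum b n f).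
Proof.
move=> cf.
have -> : dilation_sum b n f =
    \sum_(0 <= l < n) (fun s => b l *: f ((-2) ^+ l * s)).
  by apply/funext => s; rewrite fct_sumE.
elim/big_ind : _ => [|g h cg ch|l _] t.
- exact: cvg_cst.
- by apply: cvgD; [exact: cg | exact: ch].
- apply: cvgZr; apply: (@cvg_comp _ _ _ _ f); last exact: cf.
  exact: mulrl_continuous.
Qed.

End Dilations.

(** * Smoothness of series of dilations *)

Section Smoothness.
Context {R : realType}.
Implicit Types (b : nat -> R) (f g : R -> Rcomplex R).

Lemma Ck_continuous k f : Ck k f -> continuous f.
Proof.
case: k => [|k] [_ fd]; first by [].
move=> _ t; apply: differentiable_continuous.
by apply/derivable1_diffP; exact: (fd 0).
Qed.

Lemma Ck_bounded k f : Ck k f -> exists M, forall t, `|f t| <= M.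
Proof.
move=> fk; have [fT _ _] := fk.
have cn : continuous (fun t => `|f t|).
  move=> t; apply: (@cvg_comp _ _ _ f); first exact: (Ck_continuous fk).
  exact: norm_continuous.
have T0 : 0 < pi *+ 2 :> R by rewrite mulrn_wgt0 ?pi_gt0.
have [c _ hc] := EVT_max (ltW T0) (continuous_subspaceT cn).
exists `|f c| => t; rewrite -(periodicz fT (- Num.floor (t / (pi *+ 2)))).
by apply: hc; rewrite in_itv/= mulrNz modulo_period.
Qed.

Lemma derive1_is_derive f g :
  (forall t : R, is_derive t 1 f (g t)) -> f^`() = g.
Proof.
by move=> fg; apply/funext => t; rewrite derive1E; exact: derive_val.
Qed.

Lemma CkS k f g : periodic f (pi *+ 2) ->
  (forall t : R, is_derive t 1 f (g t)) -> Ck k g -> Ck k.+1 f.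
Proof.
move=> fT fg [_ gd gc]; have f'E := derive1_is_derive fg.
split=> //; last by rewrite derive1Sn f'E.
move=> [_ t|j jk t]; first exact: ex_derive.
by rewrite derive1Sn f'E; exact: gd.
Qed.

Lemma Ck_is_derive k f : Ck k.+1 f -> forall t : R, is_derive t 1 f (f^`() t).
Proof.
move=> [_ fd _] t; rewrite derive1E; apply: derivableP; exact: (fd 0).
Qed.

Lemma Ck_derive k f : Ck k.+1 f -> Ck k f^`().
Proof.
move=> fk; have [fT fd fc] := fk; split.
- move=> t; rewrite /derive1.
  suff -> : (fun h => h^-1 *: (f (h + (t + pi *+ 2)) - f (t + pi *+ 2))) =
            (fun h => h^-1 *: (f (h + t) - f t)) by [].
  by apply/funext => h; rewrite addrA !fT.
- by move=> j jk t; rewrite -derive1Sn; exact: fd.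
- by rewrite -derive1Sn.
Qed.

Lemma periodic_dilation_series b f (T : R) :
  periodic f T -> periodic (dilation_series b f) T.
Proof.
move=> fT t; rewrite /dilation_series.
suff -> : (fun n => dilation_sum b n f (t + T)) =
          (fun n => dilation_sum b n f t) by [].
apply/funext => n; apply: eq_bigr => l _; congr (_ *: _).
have -> : (-2) ^+ l = ((-2 : int) ^+ l)%:~R :> R by rewrite rmorphXn.
by rewrite mulrDr [_ * T]mulrC mulrzr periodicz.
Qed.

(** Induction on [k].  The derivative of the series is the series of [f^`()]
    with weights [b l * (-2)^l]; these decay like [(2 r)^l], and
    [2^(k+1) * r < 1] is the hypothesis of rank [k] for the ratio [2 r]. *)
Lemma Ck_dilation_series k b (C r : R) f :
  0 <= r -> 2 ^+ k * r < 1 -> (forall l, `|b l| <= C * r ^+ l) ->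
  Ck k f -> Ck k (dilation_series b f).
Proof.
elim: k b r f => [|k IH] b r f r0 r1 bC fk; have [fT _ _] := fk;
  have [M fM] := Ck_bounded fk.
- have r01 : 0 <= r < 1 by rewrite r0 -[r]mul1r.
  split => //; first exact: periodic_dilation_series.
  apply: (@continuous_uniform_limit _ (fun n => dilation_sum b n f) _ _ _
    (dilation_series_dist r01 bC fM)).
    by move=> n; apply: continuous_dilation_sum; exact: Ck_continuous fk.
  exact: cvg_geometric_bound.
- have r2 : 0 <= 2 * r by rewrite mulr_ge0.
  have r2k : 2 ^+ k * (2 * r) < 1 by rewrite mulrA -exprSr.
  have r201 : 0 <= 2 * r < 1.
    rewrite r2; apply: le_lt_trans r2k.
    by rewrite ler_peMl// exprn_ege1// ler1n.
  have r01 : 0 <= r < 1.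
    rewrite r0; case/andP: r201 => _.
    by apply: le_lt_trans; rewrite ler_peMl// ler1n.
  have b'C l : `|b l * (-2) ^+ l| <= C * (2 * r) ^+ l.
    rewrite normrM normrX normrN normr_nat exprMn [2 ^+ l * _]mulrC mulrA.
    by rewrite ler_wpM2r// exprn_ge0.
  have f'k := Ck_derive fk; have [M' f'M] := Ck_bounded f'k.
  apply: CkS (periodic_dilation_series b fT) _ (IH _ _ _ r2 r2k b'C f'k).
  set D := 2 * (C * M) / (1 - r); set D' := 2 * (C * M') / (1 - 2 * r).
  (* One error sequence has to serve the series and the derived series. *)
  pose e n := D * r ^+ n + D' * (2 * r) ^+ n.
  have H1 := dilation_series_dist r01 bC fM.
  have H2 := dilation_series_dist r201 b'C f'M.
  apply: (@is_derive_uniform_limit _ (fun n => dilation_sum b n f) _ _ _ e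
    (fun n => is_derive_dilation_sum b n (Ck_is_derive fk))).
  + move=> n t; apply: le_trans (H1 n t) _.
    by rewrite lerDl (le_trans _ (H2 n t)).
  + move=> n t; apply: le_trans (H2 n t) _.
    by rewrite lerDr (le_trans _ (H1 n t)).
  + by rewrite -(addr0 0); apply: cvgD; exact: cvg_geometric_bound.
Qed.

End Smoothness.

Section Coefficients.
Context {R : realType}.

Lemma partialR_dilation_sum (a : R) n y :
  partialR a n y = dilation_sum (fun l => (-1) ^+ l * coefR a l) n y.
Proof.
apply/funext => t; apply: eq_bigr => l _.
by rewrite -exprMn mulN1r.
Qed.

(** The smaller root satisfies [|a - s| <= a + s], so both powers are bounded by
    that of [a + s]. *)
Lemma coefR_bound (a : R) : 0 < a -> exists C, forall l,
  `|(-1) ^+ l * coefR a l| <= C * (a + Num.sqrt (a ^+ 2 + a)) ^+ l.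
Proof.
move=> a0; set s := Num.sqrt (a ^+ 2 + a).
have s0 : 0 < s by rewrite sqrtr_gt0 addr_gt0// exprn_gt0.
exists ((a + s) / s) => l.
rewrite normrMsign /coefR -/s normrM normfV.
rewrite [`|2 * s|]gtr0_norm ?mulr_gt0//.
rewrite ler_pdivrMr ?mulr_gt0//.
have -> : (a + s) / s * (a + s) ^+ l * (2 * s) =
    (a + s) ^+ l.+1 + (a + s) ^+ l.+1.
  by rewrite exprS; field; rewrite gt_eqF.
apply: le_trans (ler_normB _ _) _; rewrite !normrX.
have as0 : 0 <= a + s by rewrite addr_ge0// ltW.
rewrite [`|a + s|]ger0_norm// lerD2l lerXn2r ?nnegrE//.
by apply: le_trans (ler_normB _ _) _; rewrite !gtr0_norm.
Qed.

(** With [q = 2^k], squaring [q * s < 1 - q * a] cancels the terms in [a^2] and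
    leaves [a * q * (q + 2) < 1]. *)
Lemma ratio_lt1 (a : R) k : 0 <= a -> a < 1 / (2 ^+ k * (2 ^+ k + 2)) ->
  2 ^+ k * (a + Num.sqrt (a ^+ 2 + a)) < 1.
Proof.
move=> a0; set q := 2 ^+ k => h.
have q0 : 0 < q by rewrite exprn_gt0.
have {}h : a * (q * (q + 2)) < 1.
  by rewrite -ltr_pdivlMr// mulr_gt0// addr_gt0.
rewrite mulrDr -ltrBrDl.
have {h} E : q ^+ 2 * a < 1 - 2 * (q * a) by lra.
have qa : 0 < 1 - q * a.
  have := mulr_ge0 (sqr_ge0 q) a0; have := mulr_ge0 (ltW q0) a0; lra.
rewrite -[X in X * _ < _](ger0_norm (ltW q0)) -sqrtr_sqr -sqrtrM ?sqr_ge0//.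
rewrite -[ltRHS](gtr0_norm qa) -[ltRHS]sqrtr_sqr ltr_sqrt ?exprn_gt0//.
lra.
Qed.

End Coefficients.

(** * Null sets under affine maps *)

Section AffineNull.
Context {R : realType}.
Local Notation mu := (@lebesgue_measure R).

Lemma ae_imply (P Q : R -> Prop) : (forall t, P t -> Q t) ->
  {ae mu, forall t, P t} -> {ae mu, forall t, Q t}.
Proof.
by move=> PQ; apply: filterS => //; exact: (ae_filter_ringOfSetsType mu).
Qed.

Lemma measurable_affine (c d : R) : measurable_fun setT (fun t => c * t + d).
Proof. by apply: measurable_funD => //; apply: measurable_funM. Qed.

(** By uniqueness of Lebesgue measure, it suffices to compare the two sides on
    half-open intervals. *)
Lemma lebesgue_measure_affine (c d : R) (A : set R) : 0 < c -> measurable A ->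
  mu A = (c%:E * mu ((fun t => (c * t + d)%R) @^-1` A))%E.
Proof.
move=> c0 mA.
pose phi : measurableTypeR R -> measurableTypeR R := fun t => c * t + d.
have mphi : measurable_fun setT phi by exact: measurable_affine.
(* The push-forward is a measure only for a measurable map, so [nu] abstracts
   over a proof of measurability and is applied to [mphi]. *)
pose nu : {measure set (measurableTypeR R) -> \bar R} :=
  mscale (NngNum (ltW c0)) (pushforward mu phi).
rewrite -[RHS]/(nu mphi A); apply: lebesgue_measure_unique => // _ [[a b]] _ <-.
rewrite /nu /= /mscale /= /pushforward.
have -> : phi @^-1` `]a, b] = `](a - d) / c, (b - d) / c]%classic.
  apply/seteqP; split => t /=; rewrite !in_itv/= /phi.
    by rewrite ltr_pdivrMr// ler_pdivlMr// ltrBlDr lerBrDr mulrC.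
  by rewrite ltr_pdivrMr// ler_pdivlMr// ltrBlDr lerBrDr mulrC.
rewrite !lebesgue_measure_itv/= !lte_fin.
rewrite ltr_pM2r ?invr_gt0// ltrD2r.
case: ifPn => _; last by rewrite mule0.
by rewrite -!EFinD -EFinM; congr EFin; field; rewrite gt_eqF.
Qed.

Lemma ae_affine_pos (c d : R) (P : R -> Prop) : 0 < c ->
  {ae mu, forall t, P t} -> {ae mu, forall t, P (c * t + d)}.
Proof.
move=> c0 [N [mN N0 PN]].
exists ((fun t => c * t + d) @^-1` N); split.
- by rewrite -[X in measurable X]setTI; exact: measurable_affine.
- have := lebesgue_measure_affine d c0 mN; rewrite N0 => /esym/eqP.
  by rewrite mule_eq0 eqe gt_eqF//= => /eqP.
- by move=> t /= Pt; exact: PN.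
Qed.

Lemma ae_opp (P : R -> Prop) :
  {ae mu, forall t, P t} -> {ae mu, forall t, P (- t)}.
Proof.
move=> [N [mN N0 PN]].
exists (-%R @^-1` N); split.
- by rewrite -[X in measurable X]setTI; exact: measurable_funN.
- by rewrite -[RHS]N0 -[RHS](lebesgue_measureN mN).
- by move=> t /= Pt; exact: PN.
Qed.

Lemma ae_dilation l (P : R -> Prop) :
  {ae mu, forall t, P t} -> {ae mu, forall t, P ((-2) ^+ l * t)}.
Proof.
move=> Pae; elim: l => [|l IH].
  by move: Pae; apply: ae_imply => t; rewrite expr0 mul1r.
have := ae_affine_pos 0 (ltr0Sn R 1) (ae_opp IH).
apply: ae_imply => t; rewrite addr0 exprSr.
by rewrite -mulrA mulNr.
Qed.

(** The real line is a countable union of translates of [[0, T]], and almost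
    everywhere statements are stable under countable conjunctions. *)
Lemma ae_periodic (V : zmodType) (f g : R -> V) (T : R) : 0 < T ->
  periodic f T -> periodic g T ->
  {ae mu, forall t, 0 <= t <= T -> f t = g t} -> {ae mu, forall t, f t = g t}.
Proof.
move=> T0 fT gT fg.
have H (z : int) : {ae mu, forall t, 0 <= t - T *~ z <= T -> f t = g t}.
  have := ae_affine_pos (- (T *~ z)) ltr01 fg.
  apply: ae_imply => t; rewrite mul1r => fgt /fgt.
  by rewrite -mulrNz !periodicz.
have := ae_foralln (fun n => H (odflt 0 (unpickle n))).
apply: ae_imply => t /(_ (pickle (Num.floor (t / T)))).
by rewrite pickleK /=; apply; exact: modulo_period.
Qed.

End AffineNull.

(** * The L^2 norm over a period *)

Section MeanSquare.
Context {R : realType}.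
Local Notation mu := (@lebesgue_measure R).
Local Notation D := `[0 : R, pi *+ 2].
Implicit Types f g h : R -> Rcomplex R.

Definition cmeasurable f :=
  measurable_fun setT (fun t => complex.Re (f t)) /\
  measurable_fun setT (fun t => complex.Im (f t)).

Lemma continuous_cmeasurable f : continuous f -> cmeasurable f.
Proof.
move=> cf; split; apply: continuous_measurable_fun => t.
  by apply: (@cvg_comp _ _ _ f); [exact: cf | exact: continuous_Re].
by apply: (@cvg_comp _ _ _ f); [exact: cf | exact: continuous_Im].
Qed.

Lemma cmeasurableB f g : cmeasurable f -> cmeasurable g ->
  cmeasurable (fun t => f t - g t).
Proof.
move=> [fr fi] [gr gi]; split.
- rewrite (_ : (fun t => _) = (fun t => complex.Re (f t) - complex.Re (g t))).
    exact: measurable_funB.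
  by apply/funext => t; rewrite (raddfB (@complex.Re R : Rcomplex R -> R)).
- rewrite (_ : (fun t => _) = (fun t => complex.Im (f t) - complex.Im (g t))).
    exact: measurable_funB.
  by apply/funext => t; rewrite (raddfB (@complex.Im R : Rcomplex R -> R)).
Qed.

Lemma cmeasurable_dilation_sum (b : nat -> R) n f :
  cmeasurable f -> cmeasurable (dilation_sum b n f).
Proof.
have mc (c : R) : measurable_fun setT (fun t : R => c * t).
  exact: measurable_funM.
move=> [fr fi]; split.
- rewrite (_ : (fun t => _) = (fun t => \sum_(0 <= l < n)
      b l * complex.Re (f ((-2) ^+ l * t)))).
    apply: measurable_sum => l; apply: measurable_funM => //.
    exact: (measurableT_comp fr (mc _)).
  apply/funext => t; rewrite (raddf_sum (@complex.Re R : Rcomplex R -> R)).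
  by apply: eq_bigr => l _; case: (f _).
- rewrite (_ : (fun t => _) = (fun t => \sum_(0 <= l < n)
      b l * complex.Im (f ((-2) ^+ l * t)))).
    apply: measurable_sum => l; apply: measurable_funM => //.
    exact: (measurableT_comp fi (mc _)).
  apply/funext => t; rewrite (raddf_sum (@complex.Im R : Rcomplex R -> R)).
  by apply: eq_bigr => l _; case: (f _).
Qed.

Lemma measurable_sqr_modulus f (A : set R) : cmeasurable f ->
  measurable_fun A (fun t => (`|f t| ^+ 2)%:E).
Proof.
move=> [fr fi]; apply: measurable_funTS; apply/measurable_EFinP.
rewrite (_ : (fun t => _) =
    (fun t => complex.Re (f t) ^+ 2 + complex.Im (f t) ^+ 2)).
  by apply: measurable_funD; exact: measurable_funX.
by apply/funext => t; rewrite sqr_modulus.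
Qed.

Definition energy f : \bar R := (\int[mu]_(t in D) (`|f t| ^+ 2)%:E)%E.

Lemma energy_ge0 f : (0 <= energy f)%E.
Proof. by apply: integral_ge0 => t _; rewrite lee_fin sqr_ge0. Qed.

Lemma L2normE f : L2norm f = (energy f `^ 2^-1)%E.
Proof. by []. Qed.

Lemma lebesgue_measure_period : mu D = (pi *+ 2)%:E.
Proof.
by rewrite lebesgue_measure_itv/= lte_fin mulrn_wgt0 ?pi_gt0// -EFinD subr0.
Qed.

Lemma L2norm_le_sup f (M : R) : cmeasurable f -> (forall t, `|f t| <= M) ->
  (L2norm f <= (M * Num.sqrt (pi *+ 2))%:E)%E.
Proof.
move=> mf fM; have M0 : 0 <= M by apply: le_trans (fM 0).
have pi0 : 0 <= pi *+ 2 :> R by rewrite mulrn_wge0 ?pi_ge0.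
have eM : (energy f <= (M ^+ 2 * (pi *+ 2))%:E)%E.
  rewrite EFinM -lebesgue_measure_period -(@integral_cst _ _ _ mu D)//.
  apply: ge0_le_integral => //.
  - exact: measurable_sqr_modulus.
  - by move=> t _; rewrite lee_fin lerXn2r ?nnegrE.
rewrite L2normE.
have -> : (M * Num.sqrt (pi *+ 2))%:E = ((M ^+ 2 * (pi *+ 2))%:E `^ 2^-1)%E.
  rewrite poweR_EFin powR12_sqrt ?mulr_ge0 ?sqr_ge0//.
  by rewrite sqrtrM ?sqr_ge0// sqrtr_sqr ger0_norm.
apply: gt0_ler_poweR => //; rewrite in_itv/= ?energy_ge0 ?leey//.
by rewrite lee_fin mulr_ge0 ?sqr_ge0.
Qed.

Lemma energy_le f (d : R) : 0 <= d -> (L2norm f <= d%:E)%E ->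
  (energy f <= (d ^+ 2)%:E)%E.
Proof.
move=> d0 fd.
have -> : energy f = (L2norm f `^ 2)%E.
  by rewrite L2normE -poweRrM mulVf// poweRe1// energy_ge0.
rewrite -powR_mulrn// -poweR_EFin; apply: gt0_ler_poweR => //.
  by rewrite in_itv/= poweR_ge0 leey.
by rewrite in_itv/= lee_fin d0 leey.
Qed.

(** The parallelogram-type bound [|z - w|^2 <= 2 |z|^2 + 2 |w|^2] replaces
    Minkowski's inequality in the proof that L^2-limits are unique. *)
Lemma energyB_le f g : cmeasurable f -> cmeasurable g ->
  (energy (fun t => f t - g t)%R <= 2%:E * energy f + 2%:E * energy g)%E.
Proof.
move=> mf mg; rewrite /energy.
have mf2 := measurable_sqr_modulus (A := D) mf.
have mg2 := measurable_sqr_modulus (A := D) mg.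
rewrite -!ge0_integralZl_EFin//.
rewrite -ge0_integralD//; last 2 first.
- exact: measurable_funeM.
- exact: measurable_funeM.
apply: ge0_le_integral => //.
- by apply: measurable_sqr_modulus; exact: cmeasurableB.
- by apply: emeasurable_funD; exact: measurable_funeM.
- move=> t _; rewrite -!EFinM -EFinD lee_fin.
  by apply: le_trans (sqr_modulusD_le _ _) _; rewrite normrN.
Qed.

Lemma ae_L2norm f g : cmeasurable f -> cmeasurable g ->
  {ae mu, forall t, f t = g t} -> L2norm f = L2norm g.
Proof.
move=> mf mg fg; rewrite !L2normE; congr poweR.
apply: ge0_ae_eq_integral => //.
- exact: measurable_sqr_modulus.
- exact: measurable_sqr_modulus.
- by move: fg; apply: ae_imply => t ->.
Qed.

Lemma energy_eq0_ae f g : cmeasurable f -> cmeasurable g ->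
  periodic f (pi *+ 2) -> periodic g (pi *+ 2) ->
  energy (fun t => f t - g t) = 0%E -> {ae mu, forall t, f t = g t}.
Proof.
move=> mf mg fT gT fg0.
apply: (@ae_periodic _ _ _ _ (pi *+ 2)) => //.
  by rewrite mulrn_wgt0 ?pi_gt0.
have mfg : measurable_fun D (fun t => (`|f t - g t| ^+ 2)%:E).
  by apply: measurable_sqr_modulus; exact: cmeasurableB.
have mD : measurable (D : set R) by [].
have [H _] := ae_eq_integral_abs mu mD mfg.
have : ae_eq mu D (fun t => (`|f t - g t| ^+ 2)%:E) (cst 0%E).
  apply: H; rewrite -fg0; apply: eq_integral => t _.
  by rewrite gee0_abs// lee_fin sqr_ge0.
apply: ae_imply => t H' t0; have := H' t0.
by move=> /eqP; rewrite eqe expf_eq0/= normr_eq0 subr_eq0 => /eqP.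
Qed.

Lemma Ck_L2fun k f : Ck k f -> L2fun f.
Proof.
move=> fk; have [fT _ _] := fk; have cf := Ck_continuous fk.
have [fr fi] := continuous_cmeasurable cf.
have [M fM] := Ck_bounded fk.
split => //; apply: le_lt_trans (L2norm_le_sup _ fM) (ltry _).
exact: continuous_cmeasurable.
Qed.

End MeanSquare.

(** * The operator on classes *)

Section Operator.
Context {R : realType}.
Local Notation mu := (@lebesgue_measure R).

Lemma L2fun_cmeasurable (f : R -> Rcomplex R) : L2fun f -> cmeasurable f.
Proof. by case. Qed.

(** Each dilation [t |-> (-2)^l t] pulls null sets back to null sets, so the
    choice of a representative of a class is immaterial. *)
Lemma ae_partialR (a : R) n (y f : R -> Rcomplex R) :
  {ae mu, forall t, y t = f t} ->
  {ae mu, forall t, partialR a n y t = partialR a n f t}.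
Proof.
move=> yf; have := ae_foralln (fun l => ae_dilation l yf).
apply: ae_imply => t yft; rewrite !partialR_dilation_sum.
by apply: eq_bigr => l _; rewrite yft.
Qed.

(** A uniform limit over a bounded period is also an L^2-limit, and two
    L^2-limits of the same sequence agree almost everywhere.  Hence the class of
    [F] is exactly the value of the operator. *)
Lemma opR_L2class (a : R) (f F : R -> Rcomplex R) (e : nat -> R) :
  a != 0 -> L2fun f -> L2fun F ->
  (forall n t, `|partialR a n f t - F t| <= e n) -> e n @[n --> \oo] --> 0 ->
  opR a (L2class f) = L2class F.
Proof.
move=> a0 fL FL fF e0; rewrite /opR (negbTE a0).
have mP y n : L2fun y -> cmeasurable (partialR a n y).
  move=> /L2fun_cmeasurable my; rewrite partialR_dilation_sum.
  exact: cmeasurable_dilation_sum.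
have mF := L2fun_cmeasurable FL.
have PF0 : L2norm (fun t => partialR a n f t - F t) @[n --> \oo] --> 0%E.
  apply: (@squeeze_cvge _ _ _ _ (fun=> 0%E) _
    (fun n => (e n * Num.sqrt (pi *+ 2))%:E)).
  - near=> n; rewrite poweR_ge0/=.
    by apply: L2norm_le_sup => //; apply: cmeasurableB => //; exact: mP.
  - exact: cvg_cst.
  - apply: cvg_EFin; first by near=> n.
    by rewrite -[0](mul0r (Num.sqrt (pi *+ 2))); apply: cvgMl.
apply/seteqP; split=> [g [gL [y [yL yf] Pyg]]|g [gL gF]]; last first.
  split => //; exists f; first by split => //; exact: aeW.
  suff -> : (fun n => L2norm (fun t => partialR a n f t - g t)) =
            (fun n => L2norm (fun t => partialR a n f t - F t)) by [].
  apply/funext => n; apply: ae_L2norm.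
  - by apply: cmeasurableB; [exact: mP | exact: L2fun_cmeasurable].
  - by apply: cmeasurableB => //; exact: mP.
  - by move: gF; apply: ae_imply => t ->.
have mg := L2fun_cmeasurable gL.
split => //; apply: energy_eq0_ae => //; [by case: gL | by case: FL |].
apply/eqP; rewrite eq_le energy_ge0 andbT.
apply/lee_addgt0Pr => d d0; rewrite add0e.
(* Two energies at most [s^2], each counted twice, add up to [d]. *)
pose s := Num.sqrt (d / 4).
have s0 : 0 < s by rewrite sqrtr_gt0 divr_gt0.
have small (u : (\bar R)^nat) :
    u @ \oo --> 0%E -> \forall n \near \oo, (u n <= s%:E)%E.
  move=> /fine_cvgP[ufin /cvgrPdist_le /(_ _ s0) us]; near=> n.
  have un : u n \is a fin_num by near: n.
  rewrite -(fineK un) lee_fin; apply: le_trans (ler_norm _) _.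
  by rewrite -normrN -sub0r; near: n.
near \oo => n.
have mPf := mP f n fL; have mPy := mP y n yL.
have I1 : (energy (fun t => partialR a n f t - F t)%R <= (s ^+ 2)%:E)%E.
  by apply: energy_le (ltW s0) _; near: n; exact: small.
have I2 : (energy (fun t => partialR a n f t - g t)%R <= (s ^+ 2)%:E)%E.
  apply: energy_le (ltW s0) _.
  rewrite (@ae_L2norm _ _ (fun t => partialR a n y t - g t)).
  - by near: n; exact: small.
  - exact: cmeasurableB.
  - exact: cmeasurableB.
  - by move: (ae_partialR a n yf); apply: ae_imply => t ->.
have -> : (fun t => g t - F t) =
    (fun t => (partialR a n f t - F t) - (partialR a n f t - g t)).
  by apply/funext => t; ring.
apply: le_trans (energyB_le (cmeasurableB mPf mF) (cmeasurableB mPf mg)) _.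
apply: le_trans (leeD (lee_wpmul2l _ I1) (lee_wpmul2l _ I2)) _ => //.
rewrite -!EFinM -EFinD lee_fin.
have s2 : s ^+ 2 = d / 4 by rewrite sqr_sqrtr// divr_ge0// ltW.
rewrite s2; lra.
Unshelve. all: by end_near. Qed.

End Operator.

Theorem theoremA3 (R : realType) (a : R) (k : nat) :
  0 <= a < 1 / 3 ->
  a < 1 / (2 ^+ k * (2 ^+ k + 2)) ->
  forall Y : set (R -> Rcomplex R), CkL2 k Y -> CkL2 k (opR a Y).
Proof.
move=> /andP[a0 _] ak Y [f fk <-].
have [->|an0] := eqVneq a 0; first by rewrite /opR eqxx; exists f.
have ap : 0 < a by rewrite lt_def an0.
pose b l := (-1) ^+ l * coefR a l; pose r := a + Num.sqrt (a ^+ 2 + a).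
have r0 : 0 <= r by rewrite addr_ge0 ?sqrtr_ge0.
have rk : 2 ^+ k * r < 1 by exact: ratio_lt1.
have r01 : 0 <= r < 1.
  rewrite r0; apply: le_lt_trans rk.
  by rewrite ler_peMl// exprn_ege1// ler1n.
have [C bC] := coefR_bound ap.
have [M fM] := Ck_bounded fk.
have Fk : Ck k (dilation_series b f) by exact: Ck_dilation_series bC fk.
exists (dilation_series b f) => //; apply/esym.
apply: (opR_L2class an0 (Ck_L2fun fk) (Ck_L2fun Fk) _
  (cvg_geometric_bound (2 * (C * M) / (1 - r)) r01)) => n t.
by rewrite partialR_dilation_sum; exact: dilation_series_dist.
Qed.
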